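(* Let $\Omega$ be a finite variety whose elements are Arf numerical semigroups and let $H'=\bigcap_{H\in\Omega}H$. Then $$\langle\Omega\rangle=\langle\{H'\}\rangle,$$ where $\langle\mathcal{F}\rangle$ denotes the variety generated by a family $\mathcal{F}$ of numerical semigroups.
   Context: $\mathbb{N}$ is the set of non-negative integers. A numerical semigroup is a subset $H\subseteq\mathbb{N}$ that contains $0$, is closed under addition, and has finite complement in $\mathbb{N}$. It is Arf if $2a-b\in H$ for all $a,b\in H$ with $a\ge b$. A nonempty family $\Psi$ of numerical semigroups is a variety if: (1) $S\in\Psi$ and $S\subseteq S'$ with $S'$ a numerical semigroup imply $S'\in\Psi$; and (2) $S,S'\in\Psi$ implies $S\cap S'\in\Psi$. For a family $\mathcal{F}$ of numerical semigroups, $\langle\mathcal{F}\rangle$ is the intersection of all varieties containing $\mathcal{F}$; it is the smallest variety containing $\mathcal{F}$. *)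

(* Defs.v *)
From mathcomp Require Import all_boot.
From mathcomp Require Import boolp classical_sets cardinality.

Set Implicit Arguments.
Unset Strict Implicit.
Unset Printing Implicit Defensive.

Local Open Scope classical_set_scope.

Record numerical_semigroup (H : set nat) : Prop := NumericalSemigroup {
  nsg0 : H 0;
  nsgD : forall a b, H a -> H b -> H (a + b);
  nsg_finC : finite_set (~` H)
}.

(* The subtraction is not truncated here, since b <= a <= 2 * a. *)
Definition arf (H : set nat) : Prop :=
  forall a b, H a -> H b -> b <= a -> H (2 * a - b).

Record variety (Psi : set (set nat)) : Prop := Variety {
  variety_nsg : forall S, Psi S -> numerical_semigroup S;
  variety_neq0 : Psi !=set0;
  variety_up : forall S S', Psi S -> numerical_semigroup S' ->
    S `<=` S' -> Psi S';
  variety_setI : forall S S', Psi S -> Psi S' -> Psi (S `&` S')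
}.

(* The intersection of all the varieties containing F. When F consists of
   numerical semigroups, the variety of all numerical semigroups is one of
   them, so the intersection does not range over an empty collection. *)
Definition generated_variety (F : set (set nat)) : set (set nat) :=
  smallest variety F.

(* Main.v *)
(* A variety is closed under binary intersections, so a finite one contains its
   own intersection H'; being upward closed, any variety that contains H'
   contains every member of Omega. *)
Require Import Defs.
From mathcomp Require Import all_boot.
From mathcomp Require Import boolp classical_sets cardinality.

Local Open Scope classical_set_scope.

(** A variety contains [Omega] iff it contains [H'], so both intersections range over the same
    varieties: [H'] lies in [Omega] by [finite_setI_closed_bigcap], and varieties are upward
    closed. *)

Lemma finite_setI_closed_bigcap (T : Type) (F : set (set T)) :
  finite_set F -> F !=set0 ->
  (forall A B, F A -> F B -> F (A `&` B)) -> F (\bigcap_(A in F) A).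
Proof.
move=> /finite_seqP[s Fs] [A0 FA0] FI.
(* The seed [A0] is needed because the empty intersection [setT] may lie outside [F]; for [t = s] it
   is absorbed, as [A0] is itself in [F]. *)
suff FA0s (t : seq (set T)) :
    {subset t <= s} -> F (A0 `&` \big[setI/setT]_(A <- t) A).
  have := FA0s s (fun=> id); rewrite -bigcap_seq -Fs; congr F.
  by apply: setIidr; exact: bigcap_inf.
elim: t => [_|A t IHt tS]; first by rewrite big_nil setIT.
rewrite big_cons setICA; apply: FI.
  by rewrite Fs /=; apply: tS; rewrite mem_head.
by apply: IHt => B Bt; apply: tS; rewrite in_cons Bt orbT.
Qed.

Theorem theorem3p23 (Omega : set (set nat)) (H' : set nat)
  (Omega_variety : variety Omega)
  (Omega_finite : finite_set Omega)
  (Omega_arf : forall H, Omega H -> arf H)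
  (H'_def : H' = \bigcap_(H in Omega) H) :
  generated_variety Omega = generated_variety [set H'].
Proof.
have [Omega_nsg Omega_neq0 _ OmegaI] := Omega_variety.
have OmegaH' : Omega H' by rewrite H'_def; exact: finite_setI_closed_bigcap.
apply/seteqP; split=> S genS V [V_variety subV]; apply: genS; split=> //.
  (* Here [V] contains [H'], which is below every [H] in [Omega]. *)
  move=> H OmegaH; apply: (variety_up V_variety) (Omega_nsg _ OmegaH) _.
    exact: subV.
  by rewrite H'_def; exact: bigcap_inf.
by move=> _ ->; exact: subV.
Qed.
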